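(* Let $C=\{(x,y,z)\in\mathbb{E}^3:\ \max\{|x|,|y|,|z|\}\le 1,\ |x|+|y|+|z|\le 2\}$, let $r_2=\sqrt{830}/21$ and let $\Gamma_2=r_2B$. Then $$m(\Gamma_2,C)\le 22.$$
   Context: $B$ is the closed unit ball of $\mathbb{E}^3$ centered at the origin ${\bf o}$. A convex body is a compact convex set with nonempty interior. For a discrete set $X$ of points, $K+X$ is called a packing if the translates $K+{\bf x}$, ${\bf x}\in X$, have pairwise disjoint interiors. For a point ${\bf x}$, $H_{\bf x}$ denotes the bisector of ${\bf o}$ and ${\bf x}$, i.e. $H_{\bf x}=\{{\bf y}:\ \langle {\bf x},{\bf y}\rangle=\frac12\langle{\bf x},{\bf x}\rangle\}$. For a centrally symmetric convex body $\Gamma$ centered at the origin (a ''truncater''), its colony is $\Gamma^*=\{{\bf x}:\ \Gamma\cap H_{\bf x}\ne\emptyset\}$ (for $\Gamma=rB$ this is $2rB$). For a centrally symmetric convex body $K$ centered at the origin, $K+{\bf x}$ is an effective neighbour of $K$ with respect to $\Gamma$ if ${\bf x}\in\Gamma^*$ and ${\rm int}(K)\cap(K+{\bf x})=\emptyset$. $m(\Gamma,K)$ is the maximal number of effective neighbours of $K$ with respect to $\Gamma$ in a packing $K+X$ with ${\bf o}\in X$; that is, the maximal number of points of $X\setminus\{{\bf o}\}$ lying in $\Gamma^*$, over all such packings. *)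

(* Defs.v *)
From mathcomp Require Import all_boot all_order all_algebra.
From mathcomp Require Import all_classical all_reals all_analysis.
Set Implicit Arguments.
Unset Strict Implicit.
Unset Printing Implicit Defensive.
Import Order.TTheory GRing.Theory Num.Theory.
Import numFieldNormedType.Exports.
Local Open Scope classical_set_scope.
Local Open Scope ring_scope.

Section packing_neighbours.
Variable R : realType.
Implicit Types (x y : 'rV[R]_3) (Gamma K X : set 'rV[R]_3).

(* The library norm of 'rV[R]_3 is the sup norm, so the Euclidean structure is
   given explicitly; the topology of 'rV[R]_3 is the Euclidean one. *)
Definition dotv x y : R := \sum_i x 0 i * y 0 i.

Definition enorm x : R := Num.sqrt (dotv x x).

Definition unit_ball : set 'rV[R]_3 := [set x | enorm x <= 1].

Definition dilate (r : R) K : set 'rV[R]_3 := [set r *: x | x in K].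

Definition translate K x : set 'rV[R]_3 := [set y + x | y in K].

Definition bisector x : set 'rV[R]_3 :=
  [set y | dotv x y = 2^-1 * dotv x x].

Definition colony Gamma : set 'rV[R]_3 :=
  [set x | Gamma `&` bisector x !=set0].

Definition discrete_set X : Prop := forall x, X x -> isolated X x.

Definition packing K X : Prop :=
  discrete_set X /\ trivIset X (fun x => interior (translate K x)).

Definition effective_neighbour Gamma K x : Prop :=
  colony Gamma x /\ interior K `&` translate K x = set0.

(* A supremum in the extended reals of cardinalities (counting is +oo on
   infinite sets); the family is nonempty since X = {0} is a packing, so a
   finite value is an attained maximum. *)
Definition max_neighbours Gamma K : \bar R :=
  ereal_sup [set counting (X `&` effective_neighbour Gamma K)
            | X in [set X | packing K X /\ X 0]].

Definition cuboctahedron : set 'rV[R]_3 :=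
  [set v | let x := v 0 0 in let y := v 0 1 in let z := v 0 2%:R in
     Num.max (Num.max `|x| `|y|) `|z| <= 1 /\ `|x| + `|y| + `|z| <= 2].

Definition r2 : R := Num.sqrt 830 / 21.

Definition Gamma2 : set 'rV[R]_3 := dilate r2 unit_ball.

End packing_neighbours.

Arguments cuboctahedron R : clear implicits.
Arguments Gamma2 R : clear implicits.

(* Main.v *)
From Stdlib Require Import ZArith.
Require Import Defs.
From mathcomp Require Import all_boot all_order all_algebra.
From mathcomp Require Import all_classical all_reals all_analysis.
From mathcomp Require Import finmap ssrZ zify ring lra.
Set Implicit Arguments.
Unset Strict Implicit.
Unset Printing Implicit Defensive.
Import Order.TTheory GRing.Theory Num.Theory.
Import numFieldNormedType.Exports.

(** Let N(v) = max(|v|_oo, |v|_1 / 2) be the norm with unit ball C. Every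
    neighbour x satisfies N(x) >= 2 and |x|^2 <= 3320/441, and two of them are
    at N-distance at least 2. Hence a translate of a slightly shrunken C
    contains at most one neighbour. Integer weights are put on finitely many
    such translates, with centres in a lattice of mesh about 1/7 and invariant
    under the octahedral group, so that every point of the shell where the
    neighbours lie is covered with weight at least 594, while the total weight
    is 13584 < 23 * 594: there cannot be 23 neighbours. By symmetry it suffices
    to cover the part x >= y >= z >= 0 of the shell. This is a computation: a
    branch and bound over polytopes given by bounds on the coordinates and on
    the four forms whose values define the faces of C, so that all the
    translates are unions of such polytopes. *)

Definition zrange := (Z * Z)%type.

(** * The branch and bound computation on integer boxes *)

Section Checker.
Local Open Scope Z_scope.

(* An optimal solution of a linear program, rounded to integers. The unit of
   length is such that C has radius 7, and each centre stands for its 48 images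
   under the octahedral group. *)
Definition weighted_centres : seq (nat * seq (Z * Z * Z)) :=
  [:: (11%N, [:: (15, 10, 1)]);
      (10%N, [:: (14, 8, 6); (14, 9, 8); (14, 10, 5); (15, 9, 5); (15, 10, 2);
            (16, 8, 3); (17, 5, 3); (17, 7, 5)]);
      (9%N, [:: (11, 10, 9); (17, 4, 2); (18, 4, 2); (18, 5, 4)]);
      (8%N, [:: (12, 11, 7); (15, 8, 6); (16, 9, 2); (17, 6, 4)]);
      (7%N, [:: (12, 10, 9); (14, 8, 7); (14, 9, 7); (16, 9, 1)]);
      (6%N, [:: (16, 4, 3)]);
      (5%N, [:: (14, 9, 6); (14, 10, 1); (14, 10, 3); (15, 10, 3); (15, 10, 4);
            (17, 5, 1); (17, 6, 1)]);
      (4%N, [:: (13, 11, 5); (15, 7, 6); (15, 8, 1); (15, 9, 4); (17, 3, 1);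
            (17, 6, 5)]);
      (3%N, [:: (12, 11, 6); (15, 12, 2)]);
      (2%N, [:: (11, 10, 8); (12, 11, 5); (12, 11, 8); (13, 12, 5); (14, 11, 2);
            (16, 5, 1); (17, 2, 1); (17, 6, 2); (17, 8, 1); (18, 2, 1)]);
      (1%N, [:: (12, 10, 8); (13, 10, 6); (14, 11, 1); (15, 11, 2);
            (15, 12, 1)])].

Definition signed_copies (c : Z * Z * Z) : seq (Z * Z * Z) :=
  let: (x, y, z) := c in
  [:: (x, y, z); (x, y, - z); (x, - y, z); (x, - y, - z);
      (- x, y, z); (- x, y, - z); (- x, - y, z); (- x, - y, - z)].

Definition permuted_copies (c : Z * Z * Z) : seq (Z * Z * Z) :=
  let: (x, y, z) := c in
  [:: (x, y, z); (y, x, z); (x, z, y); (z, x, y); (y, z, x); (z, y, x)].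

Definition orbit48 (c : Z * Z * Z) : seq (Z * Z * Z) :=
  flatten [seq signed_copies d | d <- permuted_copies c].

(* The translate of 7C with centre c, as bounds on x, y, z, x + y + z,
   x + y - z, x - y + z and - x + y + z. Boxes are lists of seven ranges in the
   same order. *)
Definition slabs (c : Z * Z * Z) : seq zrange :=
  let: (x, y, z) := c in
  let slab r t := (t - r, t + r) in
  [:: slab 7 x; slab 7 y; slab 7 z; slab 14 (x + y + z); slab 14 (x + y - z);
      slab 14 (x - y + z); slab 14 (- x + y + z)].

Definition pieces : seq (nat * seq zrange) :=
  [seq (p.1, slabs d)
  | p <- weighted_centres, d <- flatten [seq orbit48 c | c <- p.2]].

Definition threshold := 594%N.

Definition overlap (i j : zrange) := (i.1 <? j.2) && (j.1 <? i.2).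
Definition within (i j : zrange) := (j.1 <=? i.1) && (i.2 <=? j.2).

Fixpoint sieve (b : seq zrange) acc (ps : seq (nat * seq zrange)) :=
  match ps with
  | [::] => (acc, [::])
  | p :: ps' =>
    if ~~ all2 overlap b p.2 then sieve b acc ps'
    else if all2 within b p.2 then sieve b (p.1 + acc)%N ps'
    else let: (acc', ps'') := sieve b acc ps' in (acc', p :: ps'')
  end.

Definition range_add (i j : zrange) : zrange := (i.1 + j.1, i.2 + j.2).
Definition range_sub (i j : zrange) : zrange := (i.1 - j.2, i.2 - j.1).
Definition range_meet (i j : zrange) : zrange := (Z.max i.1 j.1, Z.min i.2 j.2).

(** Bounds pass only from the coordinates to the four sums; conflicts in the other direction are
    detected by the linear identities among [nonpos_forms]. *)
Definition tighten (b : seq zrange) : seq zrange :=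
  match b with
  | [:: x; y; z; d; e; f; g] =>
    [:: x; y; z; range_meet d (range_add (range_add x y) z);
        range_meet e (range_sub (range_add x y) z);
        range_meet f (range_sub (range_add x z) y);
        range_meet g (range_sub (range_add y z) x)]
  | _ => b
  end.

Fixpoint lower (l : seq Z) (b : seq zrange) :=
  match l, b with
  | a :: l', i :: b' => a * (if 0 <=? a then i.1 else i.2) + lower l' b'
  | _, _ => 0
  end.

(* Coefficients (missing ones are 0) of combinations of the seven forms that are
   nonpositive when x >= y >= z >= 0; a box on which the bounds force one of
   them to be positive is empty. *)
Definition nonpos_forms : seq (seq Z) :=
  [:: [:: -1; 1]; [:: 0; -1; 1]; [:: 0; 0; -1];
      [:: 0; 0; 2; -1; 1]; [:: 0; 0; -2; 1; -1];
      [:: 0; 2; 0; -1; 0; 1]; [:: 0; -2; 0; 1; 0; -1];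
      [:: 2; 0; 0; -1; 0; 0; 1]; [:: -2; 0; 0; 1; 0; 0; -1];
      [:: 2; 0; 0; 0; -1; -1]; [:: -2; 0; 0; 0; 1; 1];
      [:: 0; 2; 0; 0; -1; 0; -1]; [:: 0; -2; 0; 0; 1; 0; 1];
      [:: 0; 0; 2; 0; 0; -1; -1]; [:: 0; 0; -2; 0; 0; 1; 1]].

Definition coord (b : seq zrange) i := nth (0, 0) b i.

(* For every u, |p|^2 >= 2 <u, p> - |u|^2; here u = (k + h, m + h, n + h) and
   <u, p> is bounded below through the ranges of x, y, z and x + y + z. *)
Definition beyond (b : seq zrange) (k m n h : Z) :=
  3321 <=? 9 * (2 * lower [:: k; m; n; h] b
                - ((k + h) * (k + h) + (m + h) * (m + h) + (n + h) * (n + h))).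

(* With x, y and d the lower bounds, (x, y, z) and (x, t, t) are guesses for the
   point of the box closest to the origin. *)
Definition excluded (b : seq zrange) :=
  let x := (coord b 0).1 in let y := (coord b 1).1 in let d := (coord b 3).1 in
  let z := d - x - y in let t := (d - x) / 2 in
  [|| ((coord b 0).2 <=? 14) && ((coord b 3).2 <=? 28),
      has (fun l => 0 <=? lower l b) nonpos_forms,
      beyond b (x - z) (y - z) 0 z | beyond b (x - t) 0 0 t].

(** Coordinates are cut first, down to length 1, and then the widest of the seven ranges. Once all
    ranges have length at most 1, [sieve] leaves no undecided piece, because the slabs have integer
    ends too. *)
Definition branch_index (b : seq zrange) :=
  let ws := [seq i.2 - i.1 | i <- b] in
  let m := foldr Z.max 0 (take 3 ws) in
  if 1 <? m then index m ws else index (foldr Z.max 0 ws) ws.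

Fixpoint check n b acc ps : bool :=
  if n is n'.+1 then
    if excluded b then true else
    let: (acc', ps') := sieve b acc ps in
    if (threshold <= acc')%N then true else
    let i := branch_index b in
    let: (lo, hi) := coord b i in
    let t := (lo + hi) / 2 in
    [&& (i < size b)%N,
     check n' (tighten (set_nth (0, 0) b i (lo, t))) acc' ps' &
     check n' (tighten (set_nth (0, 0) b i (t, hi))) acc' ps']
  else false.

Definition start : seq zrange :=
  [:: (0, 20); (0, 20); (0, 20); (0, 60); (-20, 40); (-20, 40); (-20, 20)].

(** The fuel 40 bounds the depth of the search; exhausting it would give [false]. *)
Lemma check_start : check 40 start 0 pieces = true.
Proof. by vm_compute. Qed.

End Checker.

Local Delimit Scope Z_scope with BZ.
Local Open Scope classical_set_scope.
Local Open Scope ring_scope.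

(** * Soundness of the checker *)

Section Soundness.
Variable R : realFieldType.
Implicit Types (x y z : R) (v : seq R) (b : seq zrange).

Definition Zr (a : Z) : R := (int_of_Z a)%:~R.

Lemma ZrD (a b : Z) : Zr (a + b)%BZ = Zr a + Zr b.
Proof. by rewrite /Zr -intrD; congr (_%:~R); lia. Qed.

Lemma ZrN (a : Z) : Zr (- a)%BZ = - Zr a.
Proof. by rewrite /Zr -mulrNz; congr (_%:~R); lia. Qed.

Lemma ZrB (a b : Z) : Zr (a - b)%BZ = Zr a - Zr b.
Proof. by rewrite -ZrN -ZrD. Qed.

Lemma ZrM (a b : Z) : Zr (a * b)%BZ = Zr a * Zr b.
Proof. by rewrite /Zr -intrM; congr (_%:~R); lia. Qed.

Lemma ler_Zr (a b : Z) : (a <=? b)%BZ -> Zr a <= Zr b.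
Proof. by move=> ab; rewrite /Zr ler_int; lia. Qed.

Lemma ltr_Zr (a b : Z) : (a <? b)%BZ -> Zr a < Zr b.
Proof. by move=> ab; rewrite /Zr ltr_int; lia. Qed.

Lemma ZrE : ((Zr 0 = 0) * (Zr 1 = 1) * (Zr 2 = 2) * (Zr 9 = 9) * (Zr 14 = 14) *
  (Zr 20 = 20) * (Zr 28 = 28) * (Zr 40 = 40) * (Zr 60 = 60) * (Zr 3321 = 3321) *
  (Zr (-1) = -1) * (Zr (-2) = -2) * (Zr (-20) = -20))%type.
Proof. by []. Qed.

(* Half-open, so that splitting a box is a partition and boxes that meet the
   feasible region only in a face are discarded. *)
Definition in_range (t : R) (i : zrange) := (Zr i.1 <= t) && (t < Zr i.2).
Definition in_slab (t : R) (i : zrange) := (Zr i.1 <= t) && (t <= Zr i.2).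

Definition coverage (ps : seq (nat * seq zrange)) v : nat :=
  (\sum_(p <- ps) p.1 * all2 in_slab v p.2)%N.

Lemma within_slab t i j : in_range t i -> within i j -> in_slab t j.
Proof.
move=> /andP[it ti] /andP[/ler_Zr ji /ler_Zr ij].
by rewrite /in_slab (le_trans ji it) (le_trans (ltW ti) ij).
Qed.

Lemma all2_within b s v :
  all2 in_range v b -> all2 within b s -> all2 in_slab v s.
Proof.
elim: v b s => [|t v IHv] [|i b] [|j s] //= /andP[ti vb] /andP[ij bs].
by rewrite (within_slab ti ij) (IHv _ _ vb bs).
Qed.

(** Dropping a piece only lowers the left side, so only the pieces counted through [within] call for
    an argument. *)
Lemma sieve_coverage b v acc ps : all2 in_range v b ->
  let: (acc', ps') := sieve b acc ps in
  (acc' + coverage ps' v <= acc + coverage ps v)%N.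
Proof.
move=> vb; elim: ps acc => [|p ps IHps] acc //=.
have cov_cons (q : nat * seq zrange) qs :
    coverage (q :: qs) v = (q.1 * all2 in_slab v q.2 + coverage qs v)%N.
  by rewrite /coverage big_cons.
case: ifP => _.
  by have := IHps acc; case: sieve => acc' ps'; rewrite cov_cons; lia.
case: ifP => bp.
  have := IHps (p.1 + acc)%N; case: sieve => acc' ps'.
  by rewrite cov_cons (all2_within vb bp); lia.
by have := IHps acc; case: sieve => acc' ps'; rewrite !cov_cons; lia.
Qed.

Definition forms x y z : seq R :=
  [:: x; y; z; x + y + z; x + y - z; x - y + z; - x + y + z].

Lemma in_range_add s t i j :
  in_range s i -> in_range t j -> in_range (s + t) (range_add i j).
Proof. by rewrite /in_range /= !ZrD; lra. Qed.

Lemma in_range_sub s t i j :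
  in_range s i -> in_range t j -> in_range (s - t) (range_sub i j).
Proof. by rewrite /in_range /= !ZrB; lra. Qed.

Lemma in_range_meet t i j :
  in_range t i -> in_range t j -> in_range t (range_meet i j).
Proof.
move=> /andP[it ti] /andP[jt tj]; rewrite /in_range /=.
by apply/andP; split; [case: (Z.max_spec i.1 j.1) | case: (Z.min_spec i.2 j.2)]
  => -[_ ->].
Qed.

Lemma in_tighten x y z b :
  all2 in_range (forms x y z) b -> all2 in_range (forms x y z) (tighten b).
Proof.
case: b => [|i [|j [|k [|d [|e [|f [|g [|? ?]]]]]]]] //=.
  case/and5P=> xi yj zk xd /and4P[xe xf xg _].
  rewrite xi yj zk !in_range_meet // ?in_range_sub ?in_range_add //.
  - by rewrite addrC addrCA addrC [z + _]addrC in_range_sub ?in_range_add.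
  - by rewrite addrAC in_range_sub ?in_range_add.
Qed.

Lemma in_set_nth b v i t s : all2 in_range v b -> (i < size b)%N ->
  in_range (nth 0 v i) (s, t) -> all2 in_range v (set_nth (0, 0)%BZ b i (s, t)).
Proof.
elim: b v i => [|j b IHb] [|x v] [|i] //= /andP[xj vb] ib.
  by move=> ->.
by move=> /(IHb _ _ vb ib) ->; rewrite xj.
Qed.

Definition eval_form (l : seq Z) v : R := \sum_(p <- zip l v) Zr p.1 * p.2.

Lemma lower_le l b v : all2 in_range v b -> Zr (lower l b) <= eval_form l v.
Proof.
elim: l b v => [|a l IHl] [|i b] [|t v] //=; rewrite /eval_form ?big_nil //.
move=> /andP[/andP[it ti] vb]; rewrite big_cons ZrD lerD ?IHl //= ZrM.
case: ifP => [/ler_Zr a0|a0]; first by rewrite ler_wpM2l.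
have /ltr_Zr a_lt0 : (a <? 0)%BZ by lia.
by rewrite ler_nM2l ?ltW.
Qed.

(** Upper ends are excluded, so a single negative coefficient gives strictness. Hence [excluded] may
    discard a box as soon as the lower bound of a nonpositive form is 0. *)
Lemma lower_lt l b v :
  all2 in_range v b -> has (fun a => a <? 0)%BZ (take (size b) l) ->
  Zr (lower l b) < eval_form l v.
Proof.
elim: l b v => [|a l IHl] [|i b] [|t v] //= /andP[it vb] al.
rewrite /eval_form big_cons ZrD /= -/(eval_form l v) ZrM.
case/andP: (it) => il ir.
case: ifP => [a0|a0].
  have la : has (fun a => a <? 0)%BZ (take (size b) l).
    by move: al; case/orP => //; lia.
  by rewrite ler_ltD ?IHl // ler_wpM2l // (ler_Zr a0).
have /ltr_Zr a_lt0 : (a <? 0)%BZ by lia.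
by rewrite ltr_leD ?lower_le // ltr_nM2l.
Qed.

(* N(x, y, z) >= t. *)
Definition wide (t x y z : R) : bool :=
  [|| t <= `|x|, t <= `|y|, t <= `|z| | 2 * t <= `|x| + `|y| + `|z|].

(** When C has radius 7, the squared radius of the colony is 49 * 3320/441 = 3320/9; the bound
    3321/9 leaves room for [scale]. *)
Definition shell x y z : bool :=
  wide 14 x y z && (9 * (x ^+ 2 + y ^+ 2 + z ^+ 2) < 3321).

Lemma nonpos_formsP x y z l : z <= y -> y <= x -> 0 <= z ->
  l \in nonpos_forms -> eval_form l (forms x y z) <= 0.
Proof.
move=> zy yx z0; rewrite !inE.
by do 14?case/orP; move=> /eqP->;
  rewrite /eval_form !big_cons big_nil /= !ZrE; lra.
Qed.

Lemma beyond_far x y z b k m n h : all2 in_range (forms x y z) b ->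
  beyond b k m n h -> 3321 <= 9 * (x ^+ 2 + y ^+ 2 + z ^+ 2).
Proof.
move=> xyzb /ler_Zr; rewrite !(ZrM, ZrB, ZrD).
have := lower_le [:: k; m; n; h] xyzb.
rewrite /eval_form /= !big_cons big_nil /=.
set k' := Zr k; set m' := Zr m; set n' := Zr n; set h' := Zr h.
rewrite !ZrE.
have := sqr_ge0 (x - (k' + h')); have := sqr_ge0 (y - (m' + h')).
have := sqr_ge0 (z - (n' + h')); nra.
Qed.

Lemma in_coord b v i : all2 in_range v b -> (i < size b)%N ->
  in_range (nth 0 v i) (coord b i).
Proof.
rewrite /coord.
by elim: b v i => [|j b IHb] [|x v] [|i] //= /andP[] // _ vb; apply: IHb.
Qed.

Lemma not_excluded x y z b : z <= y -> y <= x -> 0 <= z -> shell x y z ->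
  all2 in_range (forms x y z) b -> ~~ excluded b.
Proof.
move=> zy yx z0 /andP[far near] xyzb.
have sb : size b = 7%N by move: xyzb; rewrite all2E => /andP[/eqP <-].
rewrite /excluded; apply/negP => /or4P[].
(* As x is the largest coordinate, x < 14 and x + y + z < 28 contradict [wide 14]. *)
- have /andP[_] : in_range x (coord b 0).
    by apply: (@in_coord _ (forms x y z) 0 xyzb); rewrite sb.
  have /andP[_] : in_range (x + y + z) (coord b 3).
    by apply: (@in_coord _ (forms x y z) 3 xyzb); rewrite sb.
  move=> /= d_lt x_lt /andP[/ler_Zr x14 /ler_Zr d28].
  by move: far; rewrite !ZrE in x14 d28; rewrite /wide !ger0_norm; lra.
- case/hasP => l lF /ler_Zr l0.
  have : has (fun a => a <? 0)%BZ (take (size b) l).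
    have /allP/(_ l lF) :
      all (fun l => has (fun a => a <? 0)%BZ (take 7 l)) nonpos_forms by [].
    by rewrite sb.
  move/(lower_lt xyzb); have := nonpos_formsP zy yx z0 lF.
  by move: l0; rewrite ZrE; lra.
- by move=> /(beyond_far xyzb); lra.
- by move=> /(beyond_far xyzb); lra.
Qed.

(** Induction on the fuel. During the search [acc] is the weight already secured on the box and [ps]
    lists the undecided pieces; wherever the cut is made, the point lies in one of the two
    halves. *)
Lemma check_sound n b acc ps x y z :
  z <= y -> y <= x -> 0 <= z -> shell x y z ->
  all2 in_range (forms x y z) b -> check n b acc ps ->
  (threshold <= acc + coverage ps (forms x y z))%N.
Proof.
move=> zy yx z0 sh; elim: n b acc ps => [|n IHn] b acc ps xyzb //=.
rewrite (negbTE (not_excluded zy yx z0 sh xyzb)).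
have := sieve_coverage acc ps xyzb; case: sieve => acc' ps' le_cov.
case: ifP => [W_le _|_]; first by lia.
have := @in_coord _ _ (branch_index b) xyzb.
case: coord => lo hi bi; set t := (_ / 2)%BZ.
case/and3P => ib ck1 ck2; apply: leq_trans le_cov.
have /andP[/= le1 lt2] := bi ib.
have [tv|vt] := lerP (Zr t) (nth 0 (forms x y z) (branch_index b)).
  apply: IHn ck2; apply: in_tighten; apply: in_set_nth => //.
  by rewrite /in_range tv lt2.
apply: IHn ck1; apply: in_tighten; apply: in_set_nth => //.
by rewrite /in_range le1 vt.
Qed.

Lemma sorted_coverage x y z : z <= y -> y <= x -> 0 <= z -> shell x y z ->
  (threshold <= coverage pieces (forms x y z))%N.
Proof.
move=> zy yx z0 sh.
have xyz_start : all2 in_range (forms x y z) start.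
  (* In the shell the squared length is below 369 < 20^2. *)
  have x20 : x < 20 by case/andP: sh => _; nra.
  by rewrite /= /in_range /= !ZrE; lra.
exact: (check_sound zy yx z0 sh xyz_start check_start).
Qed.

End Soundness.

(** * Octahedral symmetry and the total weight *)

Section Symmetry.
Variable R : realFieldType.
Implicit Types (x y z : R).

Definition hit x y z c := all2 (@in_slab R) (forms x y z) (slabs c).

(** Up to sign, the four sums realise all sign patterns of the l1 norm. In terms of absolute values
    the symmetries become simple rewritings. *)
Lemma hitE x y z (a b c : Z) : hit x y z (a, b, c) =
  ~~ [|| 7 < `|x - Zr R a|, 7 < `|y - Zr R b|, 7 < `|z - Zr R c|
       | 14 < `|x - Zr R a| + `|y - Zr R b| + `|z - Zr R c|].
Proof.
rewrite /hit /= /in_slab /= !(ZrD, ZrB, ZrN).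
have -> : Zr R 7 = 7 by []. have -> : Zr R 14 = 14 by [].
rewrite !negb_or -!leNgt.
by case: (ger0P (x - Zr R a)); case: (ger0P (y - Zr R b));
   case: (ger0P (z - Zr R c)) => *; apply/idP/idP; lra.
Qed.

Arguments hit : simpl never.

Definition hits x y z c := count (hit x y z) (orbit48 c).

Lemma hit_opp x y z (a b c : Z) :
  hit (- x) y z (a, b, c) = hit x y z (Z.opp a, b, c).
Proof. by rewrite !hitE ZrN -opprD normrN opprK. Qed.

Lemma hit_swap12 x y z (a b c : Z) : hit y x z (a, b, c) = hit x y z (b, a, c).
Proof. by rewrite !hitE orbCA [ `|y - _| + _]addrC. Qed.

Lemma hit_swap23 x y z (a b c : Z) : hit x z y (a, b, c) = hit x y z (a, c, b).
Proof. by rewrite !hitE [X in _ || X]orbCA addrAC. Qed.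

(** A symmetry permutes each orbit, so both counts add the same 48 terms in different orders. *)
Ltac reorder_counts :=
  repeat match goal with
  | |- context [nat_of_bool ?h] => move: (nat_of_bool h) => ?
  end; lia.

Lemma hits_opp x y z c : hits (- x) y z c = hits x y z c.
Proof.
case: c => [[a b] c].
by rewrite /hits /= !hit_opp !Z.opp_involutive; reorder_counts.
Qed.

Lemma hits_swap12 x y z c : hits y x z c = hits x y z c.
Proof.
case: c => [[a b] c].
by rewrite /hits /= !(hit_swap12 x y z); reorder_counts.
Qed.

Lemma hits_swap23 x y z c : hits x z y c = hits x y z c.
Proof.
case: c => [[a b] c].
by rewrite /hits /= !(hit_swap23 x y z); reorder_counts.
Qed.

Lemma coverage_pieces x y z : coverage pieces (forms x y z) =
  (\sum_(p <- weighted_centres) \sum_(c <- p.2) p.1 * hits x y z c)%N.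
Proof.
rewrite /coverage /pieces big_allpairs_dep; apply: eq_bigr => p _.
rewrite big_flatten big_map; apply: eq_bigr => c _ /=.
by rewrite -big_distrr /hits -sum1_count [in RHS]big_mkcond.
Qed.

(** One sign change and two adjacent transpositions generate the octahedral group. *)
Lemma sorted_wlog (P : R -> R -> R -> Prop) :
  (forall x y z, P x y z -> P (- x) y z) ->
  (forall x y z, P x y z -> P y x z) ->
  (forall x y z, P x y z -> P x z y) ->
  (forall x y z, z <= y -> y <= x -> 0 <= z -> P x y z) ->
  forall x y z, P x y z.
Proof.
move=> Popp P12 P23 Psorted.
suff Pge0 x y z : 0 <= x -> 0 <= y -> 0 <= z -> P x y z.
  have Pabs x y z : P `|x| y z -> P x y z.
    by case: (ger0P x) => // _ /Popp; rewrite opprK.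
  (* Each coordinate in turn is moved to the front, made nonnegative and moved back. *)
  by move=> x y z; apply/Pabs/P12/Pabs/P12/P23/P12/Pabs/P12/P23/Pge0.
move=> x0 y0 z0.
have [xy|/ltW yx] := lerP x y; have [yz|/ltW zy] := lerP y z;
  have [xz|/ltW zx] := lerP x z.
- by apply/P12/P23/P12/Psorted.
- by apply/P12/P23/P12/Psorted => //; lra.
- by apply/P12/P23/Psorted.
- by apply/P12/Psorted.
- by apply/P23/P12/Psorted.
- by apply/P23/Psorted.
- by apply/Psorted => //; lra.
- by apply/Psorted.
Qed.

Lemma shell_coverage x y z :
  shell x y z -> (threshold <= coverage pieces (forms x y z))%N.
Proof.
have cov_eq x1 y1 z1 x2 y2 z2 : (forall c, hits x1 y1 z1 c = hits x2 y2 z2 c) ->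
    coverage pieces (forms x1 y1 z1) = coverage pieces (forms x2 y2 z2).
  move=> E; rewrite !coverage_pieces.
  by under eq_bigr do under eq_bigr do rewrite E.
move: x y z; apply: sorted_wlog => x y z; last exact: sorted_coverage.
- by rewrite (cov_eq _ _ _ _ _ _ (hits_opp x y z)) /shell /wide normrN sqrrN.
- rewrite (cov_eq _ _ _ _ _ _ (hits_swap12 x y z)) /shell /wide orbCA.
  by rewrite [ `|y| + _]addrC [y ^+ 2 + _]addrC.
- rewrite (cov_eq _ _ _ _ _ _ (hits_swap23 x y z)) /shell /wide.
  rewrite [X in (14 <= `|x|) || X]orbCA.
  by rewrite [ `|x| + `|z| + _]addrAC [x ^+ 2 + z ^+ 2 + _]addrAC.
Qed.

Lemma total_weight : (\sum_(p <- pieces) p.1 < 23 * threshold)%N.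
Proof.
rewrite /pieces big_allpairs_dep /=.
have -> : (\sum_(p <- weighted_centres)
     \sum_(d <- flatten [seq orbit48 c | c <- p.2]) p.1
   = \sum_(p <- weighted_centres) p.1 * (48 * size p.2))%N.
  apply: eq_bigr => p _; rewrite big_const_seq count_predT iter_addn_0.
  congr (_ * _)%N.
  by elim: p.2 => [|[[a b] c] s IHs] //=; rewrite IHs mulnS.
by rewrite /weighted_centres !big_cons big_nil.
Qed.

Lemma hit_narrow x y z x' y' z' c : hit x y z c -> hit x' y' z' c ->
  [/\ `|x - x'| <= 14, `|y - y'| <= 14, `|z - z'| <= 14
    & `|x - x'| + `|y - y'| + `|z - z'| <= 28].
Proof.
case: c => [[a b] c]; rewrite !hitE !negb_or -!leNgt.
set a' := Zr R a; set b' := Zr R b; set c' := Zr R c.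
move=> /and4P[xa yb zc s] /and4P[xa' yb' zc' s'].
have := ler_distD a' x x'; have := ler_distD b' y y'; have := ler_distD c' z z'.
rewrite (distrC a') (distrC b') (distrC c'); split; lra.
Qed.

End Symmetry.

(** * From packings to the shell, and the double counting *)

Section Geometry.
Variable R : realType.
Implicit Types u v w : 'rV[R]_3.

Lemma dotvE u v :
  dotv u v = u 0 0 * v 0 0 + u 0 1 * v 0 1 + u 0 2%:R * v 0 2%:R.
Proof.
rewrite /dotv !big_ord_recl big_ord0 addr0 addrA.
by congr (_ + _ + _); congr (u _ _ * v _ _); apply: val_inj.
Qed.

Definition vwide t v := wide t (v 0 0) (v 0 1) (v 0 2%:R).

Lemma cuboctahedronP v : ~~ vwide 1 v -> cuboctahedron R v.
Proof.
rewrite /vwide /wide !negb_or -!ltNge => /and4P[x1 y1 z1 s2].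
by rewrite /cuboctahedron /= !ge_max !ltW //=; lra.
Qed.

Lemma interior_translate v w :
  ~~ vwide 1 (v - w) -> interior (translate (cuboctahedron R) w) v.
Proof.
rewrite /vwide /wide !mxE !negb_or -!ltNge => /and4P[x1 y1 z1 s2].
set a := `|_| in x1 s2; set b := `|_| in y1 s2; set c := `|_| in z1 s2.
(* In a sup-norm ball of radius [e] each coordinate moves by less than [e], so the sum of absolute
   values grows by less than 3e. *)
pose e := Num.min (Num.min (1 - a) (1 - b))
                  (Num.min (1 - c) ((2 - (a + b + c)) / 3)).
have e0 : 0 < e by rewrite !lt_min; lra.
have ea : e <= 1 - a by rewrite !ge_min lexx.
have eb : e <= 1 - b by rewrite !ge_min lexx orbT.
have ec : e <= 1 - c by rewrite !ge_min lexx !orbT.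
have es : e <= (2 - (a + b + c)) / 3 by rewrite !ge_min lexx !orbT.
apply/nbhs_ballP; exists e => // u vu.
exists (u - w); last by rewrite subrK.
have near i : `|(u - w) 0 i| < `|v 0 i - w 0 i| + e.
  have : ball (v 0 i) e (u 0 i) by case: vu => _; apply.
  rewrite -ball_normE /ball_ /= !mxE => vui.
  have := ler_distD (v 0 i) (u 0 i) (w 0 i).
  by rewrite (distrC (u 0 i) (v 0 i)); lra.
apply: cuboctahedronP; rewrite /vwide /wide !negb_or -!ltNge.
have := near 0; have := near 1; have := near 2%:R.
rewrite -/a -/b -/c; lra.
Qed.

Lemma halve_wide v : ~~ vwide 2 v -> ~~ vwide 1 (2^-1 *: v).
Proof.
rewrite /vwide /wide !mxE !normrM !(ger0_norm (x := 2^-1)) ?invr_ge0 //.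
by rewrite !negb_or -!ltNge; lra.
Qed.

Lemma vwideN t v : vwide t (- v) = vwide t v.
Proof. by rewrite /vwide /wide !mxE !normrN. Qed.

(** If N(v - w) < 2, the midpoint of v and w is interior to both translates. *)
Lemma packing_wide X v w : packing (cuboctahedron R) X ->
  X v -> X w -> v != w -> vwide 2 (v - w).
Proof.
move=> [_ triv] Xv Xw; apply: contraNT => /halve_wide near.
apply/eqP/triv => //; exists (2^-1 *: (v + w)).
split; apply: interior_translate.
  rewrite (_ : _ - v = - (2^-1 *: (v - w))) ?vwideN //.
  by apply/rowP => i; rewrite !mxE; lra.
rewrite (_ : _ - w = 2^-1 *: (v - w)) //.
by apply/rowP => i; rewrite !mxE; lra.
Qed.

Lemma effective_neighbour_wide Gamma v :
  effective_neighbour Gamma (cuboctahedron R) v -> vwide 2 v.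
Proof.
move=> [_ disj]; apply: contraT => /halve_wide near.
(* The midpoint of the origin and v would be interior to C and lie in C + v. *)
suff : set0 (2^-1 *: v) by [].
rewrite -disj; split.
  have -> : cuboctahedron R = translate (cuboctahedron R) 0.
    apply/seteqP; split => u /= => [Cu|[w Cw <-]]; last by rewrite addr0.
    by exists u; rewrite ?addr0.
  by apply: interior_translate; rewrite subr0.
exists (- (2^-1 *: v)); first by apply: cuboctahedronP; rewrite vwideN.
by apply/rowP => i; rewrite !mxE; lra.
Qed.

(** By Cauchy-Schwarz, a point of the ball of radius [r2] on the bisector forces |v|^2 / 2 <= [r2]
    |v|, and 4 * 830/441 = 3320/441. *)
Lemma colony_dotv v : colony (Gamma2 R) v -> 441 * dotv v v <= 3320.
Proof.
move=> [_ [[u u1 <-]]]; rewrite /bisector /= !dotvE !mxE => bis.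
have r2E : (r2 R) ^+ 2 = 830 / 441.
  by rewrite /r2 expr_div_n sqr_sqrtr ?ler0n //; lra.
have {u1} u1 : u 0 0 ^+ 2 + u 0 1 ^+ 2 + u 0 2%:R ^+ 2 <= 1.
  move: u1; rewrite /unit_ball /= /enorm dotvE -!expr2 => u1.
  by rewrite -(@ler_sqrt _ _ 1) // sqrtr1.
move: bis r2E u1; set r := r2 R.
set x := v 0 0; set y := v 0 1; set z := v 0 2%:R.
set a := u 0 0; set b := u 0 1; set c := u 0 2%:R.
move=> bis r2E u1.
have cs : (x * a + y * b + z * c) ^+ 2 <= x * x + y * y + z * z.
  have : (x * a + y * b + z * c) ^+ 2
     <= (x * x + y * y + z * z) * (a ^+ 2 + b ^+ 2 + c ^+ 2).
    have := sqr_ge0 (x * b - y * a); have := sqr_ge0 (x * c - z * a).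
    by have := sqr_ge0 (y * c - z * b); nra.
  have := sqr_ge0 x; have := sqr_ge0 y; have := sqr_ge0 z.
  by nra.
have S0 : 0 <= x * x + y * y + z * z.
  by have := sqr_ge0 x; have := sqr_ge0 y; have := sqr_ge0 z; nra.
move: cs bis S0; set S := x * x + y * y + z * z; set T := x * a + y * b + z * c.
move=> cs bis S0.
have : (2^-1 * S) ^+ 2 = 830 / 441 * T ^+ 2.
  by rewrite -r2E -bis /T; ring.
have [->|S_neq0] := eqVneq S 0; first by lra.
have S_gt0 : 0 < S by rewrite lt0r S_neq0.
rewrite leNgt => E; apply/negP => big.
by nra.
Qed.

(* Slightly more than 7, so that translates of 7C have N-diameter < 2 * scale,
   while 9 * scale^2 * 3320/441 is still less than 3321. *)
Definition scale : R := 7 + 1000^-1.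

Definition scaled_forms v :=
  forms (scale * v 0 0) (scale * v 0 1) (scale * v 0 2%:R).

Lemma neighbour_coverage v :
  effective_neighbour (Gamma2 R) (cuboctahedron R) v ->
  (threshold <= coverage pieces (scaled_forms v))%N.
Proof.
move=> nv; apply: shell_coverage.
have := effective_neighbour_wide nv; have [/colony_dotv + _] := nv.
have k7 : 7 <= scale by rewrite /scale; lra.
have k2 : 9 * scale ^+ 2 * 3320 < 3321 * 441 by rewrite /scale; lra.
have k0 : 0 <= scale by lra.
rewrite dotvE /vwide /shell /wide !normrM (ger0_norm k0).
move: scale k7 k2 k0 => k k7 k2 k0.
set x := v 0 0; set y := v 0 1; set z := v 0 2%:R => r22 w2.
apply/andP; split.
  have k14 (t : R) : 2 <= t -> 14 <= k * t by nra.
  rewrite -!mulrDr; case/or4P: w2 => w2; apply/or4P.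
  - by apply: Or41; apply: k14.
  - by apply: Or42; apply: k14.
  - by apply: Or43; apply: k14.
  - by apply: Or44; nra.
by rewrite !exprMn -!mulrDr; nra.
Qed.

Lemma coverage_overlap v w d : all2 (@in_slab R) (scaled_forms v) (slabs d) ->
  all2 (@in_slab R) (scaled_forms w) (slabs d) -> ~~ vwide 2 (v - w).
Proof.
move=> vd wd; have := hit_narrow vd wd.
have k7 : 7 < scale by rewrite /scale; lra.
have k0 : 0 <= scale by lra.
rewrite -!mulrBr !normrM (ger0_norm k0) /vwide /wide !mxE.
move: scale k7 {k0 vd wd} => k k7 [x14 y14 z14 s28].
have lt2 (t : R) : 0 <= t -> k * t <= 14 -> t < 2 by nra.
rewrite !negb_or -!ltNge !lt2 ?normr_ge0 //=.
by move: s28; rewrite -!mulrDr => s28; nra.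
Qed.

Lemma packing_bound X (s : seq 'rV[R]_3) :
  packing (cuboctahedron R) X -> uniq s ->
  (forall v, v \in s ->
    X v /\ effective_neighbour (Gamma2 R) (cuboctahedron R) v) ->
  (size s <= 22)%N.
Proof.
move=> packX us sX.
have lower_sum :
    (size s * threshold <= \sum_(v <- s) coverage pieces (scaled_forms v))%N.
  have -> : (size s * threshold = \sum_(v <- s) threshold)%N.
    by rewrite big_const_seq count_predT iter_addn_0 mulnC.
  rewrite big_seq [leqRHS]big_seq.
  by apply: leq_sum => v /sX[_]; apply: neighbour_coverage.
have upper_sum :
    (\sum_(v <- s) coverage pieces (scaled_forms v)
     <= \sum_(p <- pieces) p.1)%N.
  (* After exchanging the sums, it suffices that each piece contains at most one scaled
     neighbour. *)
  rewrite exchange_big big_seq [leqRHS]big_seq; apply: leq_sum => p.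
  case/allpairsPdep => [[k cs]] [d] [_ _ ->] /=.
  rewrite -big_distrr -[leqRHS]muln1 leq_mul //=.
  rewrite (_ : \sum_(v <- s) _ =
      count (fun v => all2 (@in_slab R) (scaled_forms v) (slabs d)) s)%N;
    last first.
    by rewrite -sum1_count [RHS]big_mkcond.
  rewrite -size_filter; set t := seq.filter _ s.
  have : {subset t <= s} by move=> v; rewrite mem_filter => /andP[].
  have : all (fun v => all2 (@in_slab R) (scaled_forms v) (slabs d)) t.
    exact: filter_all.
  have : uniq t by apply: filter_uniq.
  case: t => [|v [|w t]] //= /andP[] + _ /and3P[vd wd _] ts.
  rewrite inE negb_or => /andP[vw _].
  have [Xv _] := sX v (ts _ (mem_head _ _)).
  have wt : w \in [:: v, w & t] by rewrite !inE eqxx orbT.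
  have [Xw _] := sX w (ts w wt).
  have := packing_wide packX Xv Xw vw.
  by rewrite (negbTE (coverage_overlap vd wd)).
have := leq_ltn_trans (leq_trans lower_sum upper_sum) total_weight.
by rewrite ltn_pmul2r.
Qed.

End Geometry.

Theorem theorem4p6 (R : realType) :
  (max_neighbours (Gamma2 R) (cuboctahedron R) <= (22%:R)%:E)%E.
Proof.
apply: ge_ereal_sup => _ [X [packX _] <-].
set A := X `&` _.
have sizeA (s : seq 'rV[R]_3) : uniq s -> {subset s <= [pred v | `[< A v >]]} ->
    (size s <= 22)%N.
  by move=> us sA; apply: (packing_bound packX us) => v /sA /asboolP.
(* Since [counting] is infinite on infinite sets, finiteness comes first: an infinite set would
   contain 23 neighbours. *)
have finA : finite_set A.
  apply: contrapT => /(infinite_set_fset 23)[F FA].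
  rewrite leqNgt ltnS sizeA ?fset_uniq // => v vF.
  by apply/asboolP/FA.
rewrite /counting asboolT // lee_fin ler_nat sizeA ?fset_uniq // => v.
by rewrite in_fset_set // inE => Av; apply/asboolP.
Qed.
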